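(* Let $d,n\ge 1$ and let $\mathbf{E}=\{E_a\}_{a=1}^n$ be an $n$-outcome POVM on $\mathbb{C}^d$. Let $R$ be the finite set of all vectors $\vec r=(r_1,\dots,r_n)$ of non-negative integers with $\sum_{a=1}^n r_a=d$. If $\mathbf{E}$ is projectively simulable, then there exist $d\times d$ matrices $F_{a|\vec r}$ ($a\in\{1,\dots,n\}$, $\vec r\in R$) and real numbers $q_{\vec r}$ ($\vec r\in R$) such that $$\sum_{\vec r\in R}F_{a|\vec r}=E_a\ \ \forall a,\qquad \operatorname{tr}(F_{a|\vec r})=q_{\vec r}\,r_a\ \ \forall a,\vec r,\qquad \sum_{a=1}^n F_{a|\vec r}=q_{\vec r}\,\mathbb{1}\ \ \forall \vec r,\qquad F_{a|\vec r}\succeq 0\ \ \forall a,\vec r .$$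
   Context: An $n$-outcome POVM on $\mathbb{C}^d$ is a tuple $\{E_a\}_{a=1}^n$ of positive semidefinite $d\times d$ complex matrices with $\sum_a E_a=\mathbb{1}$. An $n$-outcome projective measurement is a POVM $\{P_a\}_{a=1}^n$ whose elements are all orthogonal projections ($P_a^2=P_a=P_a^\dagger$); some $P_a$ may be zero. A POVM $\{E_a\}_{a=1}^n$ is projectively simulable if there are a finite probability distribution $\{q_\lambda\}_\lambda$ and, for each $\lambda$, an $n$-outcome projective measurement $\{P_{a|\lambda}\}_{a=1}^n$ on $\mathbb{C}^d$ such that $E_a=\sum_\lambda q_\lambda P_{a|\lambda}$ for all $a$. *)

(* Defs.v *)
From HB Require Import structures.
From mathcomp Require Import all_boot all_order all_algebra.
From mathcomp Require Import sesquilinear spectral.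
From mathcomp Require Import reals.
From mathcomp Require Import complex.

Set Implicit Arguments.
Unset Strict Implicit.
Unset Printing Implicit Defensive.

Import Order.TTheory GRing.Theory Num.Theory.

Local Open Scope ring_scope.
Local Open Scope complex_scope.
Local Open Scope sesquilinear_scope.

(* The complex numbers are R[i] for R : realType.  In the order of R[i],
   0 <= z means that z is real and nonnegative. *)

Definition psdmx (R : realType) (d : nat) (A : 'M[R[i]]_d) : Prop :=
  A \is hermsymmx /\ forall x : 'cV[R[i]]_d, 0 <= (x ^t* *m A *m x) 0 0.

Definition POVM (R : realType) (d n : nat) (E : 'I_n -> 'M[R[i]]_d) : Prop :=
  (forall a, psdmx (E a)) /\ \sum_a E a = 1%:M.

Definition orthogonal_projection (R : realType) (d : nat) (P : 'M[R[i]]_d)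
    : Prop :=
  P *m P = P /\ P ^t* = P.

Definition projective_measurement (R : realType) (d n : nat)
    (P : 'I_n -> 'M[R[i]]_d) : Prop :=
  POVM P /\ forall a, orthogonal_projection (P a).

Definition projectively_simulable (R : realType) (d n : nat)
    (E : 'I_n -> 'M[R[i]]_d) : Prop :=
  exists (m : nat) (q : 'I_m -> R) (P : 'I_m -> 'I_n -> 'M[R[i]]_d),
    [/\ forall l, 0 <= q l,
        \sum_l q l = 1,
        forall l, projective_measurement (P l)
      & forall a, E a = \sum_l (q l)%:C *: P l a].

(* Nonnegative integers summing to d are at most d, so letting the entries
   range over 'I_d.+1 loses no vector. *)
Definition rank_vectors (d n : nat) : {set {ffun 'I_n -> 'I_d.+1}} :=
  [set r : {ffun 'I_n -> 'I_d.+1} | (\sum_(a < n) r a == d)%N].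

(* Main.v *)
(* Group the projective measurements of the simulation by their rank vectors
   r_a = rank P_a = tr P_a: F_{a|r} collects the weighted P_a whose measurement
   has rank vector r, and q_r is the total weight of those measurements. *)

Require Import Defs.
From mathcomp Require Import all_boot all_order all_algebra.
From mathcomp Require Import sesquilinear spectral.
From mathcomp Require Import reals complex.

Set Implicit Arguments.
Unset Strict Implicit.
Unset Printing Implicit Defensive.

Import Order.TTheory GRing.Theory Num.Theory.

Local Open Scope ring_scope.
Local Open Scope complex_scope.
Local Open Scope sesquilinear_scope.

(* In a rank factorization [P = C *m B], idempotence forces [B *m C = 1]. *)
Lemma mxtrace_idempotent (F : fieldType) (d : nat) (P : 'M[F]_d) :
  P *m P = P -> \tr P = (\rank P)%:R.
Proof.
move=> PP; have BC1 : row_base P *m col_base P = 1%:M.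
  (* Cancelling [col_base P] on the left and [row_base P] on the right reduces the claim to
     [P *m P = P]. *)
  apply: (row_full_inj (col_base_full P)).
  apply: (row_free_inj (row_base_free P)).
  by rewrite mulmx1 mulmxA !mulmx_base -mulmxA mulmx_base PP.
by rewrite -[in LHS](mulmx_base P) mxtrace_mulC BC1 mxtrace1.
Qed.

(** With [psdmxD] and [psdmxZ], makes the positive semidefinite matrices a convex cone; zero covers
    empty sums. *)
Lemma psdmx0 (R : realType) (d : nat) : psdmx (0 : 'M[R[i]]_d).
Proof.
split=> [|x]; last by rewrite mulmx0 mul0mx mxE.
by apply/is_hermitianmxP; rewrite trmx0 map_mx0 scaler0.
Qed.

Lemma psdmxD (R : realType) (d : nat) (A B : 'M[R[i]]_d) :
  psdmx A -> psdmx B -> psdmx (A + B).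
Proof.
move=> [/is_hermitianmxP hA pA] [/is_hermitianmxP hB pB]; split=> [|x].
  apply/is_hermitianmxP.
  by rewrite linearD /= map_mxD scalerDr -hA -hB.
by rewrite mulmxDr mulmxDl mxE addr_ge0.
Qed.

Lemma psdmxZ (R : realType) (d : nat) (c : R) (A : 'M[R[i]]_d) :
  0 <= c -> psdmx A -> psdmx (c%:C *: A).
Proof.
move=> c0 [/is_hermitianmxP hA pA]; split=> [|x].
  apply/is_hermitianmxP.
  rewrite linearZ /= map_mxZ /= scalerA mulrC -scalerA -hA.
  by rewrite conj_Creal // ger0_real ?ler0c.
by rewrite -scalemxAr -scalemxAl mxE mulr_ge0 ?ler0c.
Qed.

(** Take traces in [\sum_a P a = 1]: each trace is a rank, and the equality descends from [R[i]] to
    naturals by characteristic zero. *)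
Lemma projective_measurement_rank_sum (R : realType) (d n : nat)
    (P : 'I_n -> 'M[R[i]]_d) :
  projective_measurement P -> (\sum_(a < n) \rank (P a) = d)%N.
Proof.
move=> [[_ sumP] projP]; apply/eqP; rewrite -(eqr_nat R[i]) natr_sum.
rewrite -(mxtrace1 R[i] d) -sumP raddf_sum /=; apply/eqP/eq_bigr => a _.
by rewrite mxtrace_idempotent //; case: (projP a).
Qed.

Theorem mainTheorem1 (R : realType) (d n : nat) (hd : (1 <= d)%N)
    (hn : (1 <= n)%N) (E : 'I_n -> 'M[R[i]]_d) (hE : POVM E)
    (hsim : projectively_simulable E) :
  exists (F : 'I_n -> {ffun 'I_n -> 'I_d.+1} -> 'M[R[i]]_d)
         (q : {ffun 'I_n -> 'I_d.+1} -> R),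
    [/\ forall a, \sum_(r in rank_vectors d n) F a r = E a,
        forall a r, r \in rank_vectors d n ->
          \tr (F a r) = (q r)%:C * (r a : nat)%:R,
        forall r, r \in rank_vectors d n ->
          \sum_(a < n) F a r = (q r)%:C%:M
      & forall a r, r \in rank_vectors d n -> psdmx (F a r)].
Proof.
case: hsim => m [p [P [p_ge0 _ projP defE]]].
(* A rank is at most [d], so [inord] never falls back to its default value. *)
pose rk l : {ffun 'I_n -> 'I_d.+1} := [ffun a => inord (\rank (P l a))].
have rkE l a : rk l a = \rank (P l a) :> nat.
  by rewrite ffunE inordK // ltnS rank_leq_row.
have rk_in l : rk l \in rank_vectors d n.
  rewrite inE (eq_bigr (fun a => \rank (P l a))) => [|a _]; last exact: rkE.
  by rewrite projective_measurement_rank_sum.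
(* No normalisation within a class: a rank vector that no measurement attains gets zero matrices and
   zero weight. *)
exists (fun a r => \sum_(l | rk l == r) (p l)%:C *: P l a).
exists (fun r => \sum_(l | rk l == r) p l); split.
- move=> a; rewrite defE.
  (* By [rk_in], every [l] falls in exactly one class, so no term is lost. *)
  by rewrite [RHS](partition_big rk (mem (rank_vectors d n))) /=.
- move=> a r _; rewrite raddf_sum rmorph_sum mulr_suml /=.
  (* Within the class of [r], every [P l a] has the same trace [r a], which therefore factors out of
     the sum. *)
  apply: eq_bigr => l /eqP <-; rewrite mxtraceZ rkE mxtrace_idempotent //.
  by case: (projP l) => _ /(_ a) [].
- move=> r _; rewrite exchange_big rmorph_sum raddf_sum /=.
  apply: eq_bigr => l _; rewrite -scaler_sumr.
  by case: (projP l) => -[_ ->] _; rewrite scalemx1.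
- move=> a r _; apply: big_ind => [||l _]; first exact: psdmx0.
    exact: psdmxD.
  by apply: psdmxZ => //; case: (projP l) => -[].
Qed.
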